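(* Let $\mathfrak{g}$ be an AE-Lie algebra over $\mathbb{K}\in\{\mathbb{R},\mathbb{C}\}$, let $\xi\in\mathfrak{g}$ and $R\ge1$. Then $\exp(\xi)\notin\widehat{\mathrm{S}}{}_R^\bullet(\mathfrak{g})$, where $\exp(\xi)=\sum_{n=0}^\infty\frac{\xi^n}{n!}$.
   Context: Let $\mathbb{K}$ be $\mathbb{R}$ or $\mathbb{C}$. AE-Lie algebra: a Hausdorff locally convex Lie algebra $\mathfrak{g}$ over $\mathbb{K}$ (Lie bracket jointly continuous) such that every continuous seminorm $p$ has an asymptotic estimate, i.e. a continuous seminorm $q$ with $p(w_n(x_1,\dots,x_n))\le q(x_1)\cdots q(x_n)$ for all $n\ge1$, all $x_1,\dots,x_n\in\mathfrak{g}$ and all words $w_n$ made out of $n-1$ Lie brackets of $x_1,\dots,x_n$ with arbitrary placement of brackets. For a continuous seminorm $p$ on $\mathfrak{g}$ let $p^n=p^{\otimes n}$ be its projective tensor power on $\mathfrak{g}^{\otimes n}$ ($p^0=|\cdot|$ on $\mathbb{K}$). $\mathrm{S}^n(\mathfrak{g})\subseteq\mathfrak{g}^{\otimes n}$ denotes the symmetric tensors with the projective topology, $\widehat{\mathrm{S}^n_\pi}(\mathfrak{g})$ its completion, and $\xi^n=\xi\otimes\cdots\otimes\xi\in\mathrm{S}^n(\mathfrak{g})$. For $R\in\mathbb{R}$ put $p_R(x)=\sum_{n=0}^\infty n!^Rp^n(x_n)\in[0,\infty]$ for $x=\sum_nx_n\in\prod_{n}\widehat{\mathrm{S}^n_\pi}(\mathfrak{g})$.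 Then $\widehat{\mathrm{S}}{}_R^\bullet(\mathfrak{g})=\{x\in\prod_{n}\widehat{\mathrm{S}^n_\pi}(\mathfrak{g}):p_R(x)<\infty\text{ for all continuous seminorms }p\}$, which is the completion of $\mathrm{S}^\bullet(\mathfrak{g})=\bigoplus_n\mathrm{S}^n(\mathfrak{g})$ with respect to the seminorms $p_R$. The series $\exp(\xi)$ is regarded as an element of $\prod_{n}\widehat{\mathrm{S}^n_\pi}(\mathfrak{g})$.
   Formalization: The element ξ is assumed to be nonzero: for ξ = 0 the claim fails, since exp(0) = 1 has p_R(exp(0)) = 1 < ∞ for every continuous seminorm p and so lies in the completed algebra. *)

(* Defs.v *)
From HB Require Import structures.
From mathcomp Require Import all_boot all_order all_algebra all_fingroup.
From mathcomp Require Import complex.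
From mathcomp Require Import all_classical all_reals all_analysis.

Set Implicit Arguments.
Unset Strict Implicit.
Unset Printing Implicit Defensive.

Import Order.TTheory GRing.Theory Num.Theory.
Import numFieldNormedType.Exports.

Local Open Scope classical_set_scope.
Local Open Scope ring_scope.

Section TensorPower.
Variables (K : fieldType) (V : lmodType K) (n : nat).
Implicit Types (x : 'I_n -> V) (s : 'S_n).

Definition multilinear (W : lmodType K) (f : ('I_n -> V) -> W) : Prop :=
  forall x (i : 'I_n) (a : K) (u v : V),
    f (dfwith x i (a *: u + v)) = a *: f (dfwith x i u) + f (dfwith x i v).

Definition multilinear_form := {f : ('I_n -> V) -> K^o | multilinear f}.

(* The algebraic tensor power is realised, as in Ryan, Introduction to Tensor
   Products of Banach Spaces, section 1.1, inside the linear functionals on the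
   space of multilinear forms: x_1 (x) ... (x) x_n is the evaluation functional
   f |-> f (x_1, ..., x_n), and the tensors are the finite sums of multiples of
   these.  That this is the usual tensor power is tensor_power_universal. *)
Definition evaluation x : multilinear_form -> K^o := fun f => sval f x.

Definition is_tensor : {pred (multilinear_form -> K^o)} :=
  fun t => `[< exists r : seq (K * ('I_n -> V)),
                 t = \sum_(c <- r) c.1 *: evaluation c.2 >].

Lemma is_tensor_submod : submod_closed is_tensor.
Proof.
split; first by apply/asboolP; exists [::]; rewrite big_nil.
move=> a _ _ /asboolP[r1 ->] /asboolP[r2 ->]; apply/asboolP.
exists ([seq (a * c.1, c.2) | c <- r1] ++ r2).
rewrite big_cat big_map scaler_sumr; congr (_ + _).
by apply: eq_bigr => c _; rewrite scalerA.
Qed.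
HB.instance Definition _ :=
  GRing.isSubmodClosed.Build K (multilinear_form -> K^o) is_tensor
    is_tensor_submod.

Record tensor_power := Tensor {
  functional_of : multilinear_form -> K^o;
  functional_ofP : functional_of \in is_tensor }.
HB.instance Definition _ := [isSub for functional_of].
HB.instance Definition _ := [Choice of tensor_power by <:].
HB.instance Definition _ := [SubChoice_isSubLmodule of tensor_power by <:].

Lemma evaluation_is_tensor x : evaluation x \in is_tensor.
Proof.
by apply/asboolP; exists [:: (1, x)]; rewrite big_seq1 scale1r.
Qed.

Definition pure_tensor x : tensor_power := Tensor (evaluation_is_tensor x).

Definition tensor_of_seq (r : seq (K * ('I_n -> V))) : tensor_power :=
  \sum_(c <- r) c.1 *: pure_tensor c.2.

Lemma functional_of_seq (r : seq (K * ('I_n -> V))) :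
  functional_of (tensor_of_seq r) = \sum_(c <- r) c.1 *: evaluation c.2.
Proof. by elim: r => [|c r]; rewrite /tensor_of_seq ?big_nil // !big_cons => <-. Qed.

Lemma multilinear_perm (f : multilinear_form) s :
  multilinear (fun x => sval f (x \o s) : K^o).
Proof.
have E x i u : dfwith x i u \o s = dfwith (x \o s) (s^-1%g i) u.
  apply/funext => j /=; have [<-|ne] := eqVneq (s^-1%g i) j.
    by rewrite dfwithin permKV dfwithin.
  by rewrite !dfwithout //; apply: contra ne => /eqP ->; rewrite permK.
by move=> x i a u v; rewrite !E; exact: (svalP f).
Qed.

Definition perm_form (f : multilinear_form) s : multilinear_form :=
  exist _ _ (multilinear_perm f s).

Lemma perm_is_tensor (t : tensor_power) s :
  (fun f => functional_of t (perm_form f s)) \in is_tensor.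
Proof.
case: t => t /= /asboolP[r ->]; apply/asboolP.
exists [seq (c.1, c.2 \o s) | c <- r]; rewrite big_map.
by apply/funext => f; rewrite !fct_sumE.
Qed.

Definition perm_tensor (t : tensor_power) s : tensor_power :=
  Tensor (perm_is_tensor t s).

Lemma perm_pure_tensor x s :
  perm_tensor (pure_tensor x) s = pure_tensor (x \o s).
Proof. exact: val_inj. Qed.

Definition is_symmetric : {pred tensor_power} :=
  fun t => `[< forall s, perm_tensor t s = t >].

Lemma is_symmetric_submod : submod_closed is_symmetric.
Proof.
split; first by apply/asboolP => s; exact: val_inj.
move=> a t u /asboolP st /asboolP su; apply/asboolP => s.
by rewrite -[in RHS](st s) -[in RHS](su s); exact: val_inj.
Qed.
HB.instance Definition _ :=
  GRing.isSubmodClosed.Build K tensor_power is_symmetric is_symmetric_submod.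

Record sym_power := Sym {
  tensor_of : tensor_power;
  tensor_ofP : tensor_of \in is_symmetric }.
HB.instance Definition _ := [isSub for tensor_of].
HB.instance Definition _ := [Choice of sym_power by <:].
HB.instance Definition _ := [SubChoice_isSubLmodule of sym_power by <:].

Lemma diagonal_is_symmetric (v : V) : pure_tensor (fun=> v) \in is_symmetric.
Proof. by apply/asboolP => s; rewrite perm_pure_tensor. Qed.

Definition sym_pow (v : V) : sym_power := Sym (diagonal_is_symmetric v).

End TensorPower.

Section TensorUniversal.
Variables (K : fieldType) (V : lmodType K) (n : nat).

(* A vector is separated from 0 by a linear functional, obtained as the graph
   of a maximal partial functional. *)
Lemma separating_functional (W : lmodType K) (w : W) : w != 0 ->
  exists2 l : W -> K^o, linear l & l w != 0.
Proof.
move=> w0.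
pose good (A : set (W * K^o)) := [/\ A (0, 0),
  forall a y z, A y -> A z -> A (a *: y.1 + z.1, a *: y.2 + z.2)
  & forall b, A (0, b) -> b = 0].
pose A0 : set (W * K^o) := [set y | exists a, y = (a *: w, a)].
have gA0 : good A0.
  split; first by exists 0; rewrite scale0r.
  - move=> a _ _ [b ->] [c ->]; exists (a * b + c) => /=.
    by rewrite scalerDl scalerA.
  - move=> b [a [/esym/eqP]]; rewrite scaler_eq0 (negPf w0) orbF.
    by move=> /eqP -> ->.
have [M [[gM A0M] Mmax]] : exists M, (good M /\ A0 `<=` M) /\
    forall B, M `<` B -> ~ (good B /\ A0 `<=` B).
  have [|M [gM Mmax]] := @Zorn_bigcup _ [set A | A = set0 \/ (good A /\ A0 `<=` A)].
    move=> F Fgood Ftot.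
    have [Fe|] := pselect (forall X, F X -> X = set0).
      left; rewrite -subset0 => y [X FX]; rewrite (Fe _ FX) //.
    move=> /existsNP [X0 /not_implyP [FX0 /eqP/set0P X00]].
    have X0g : good X0 /\ A0 `<=` X0.
      by case: (Fgood _ FX0) => // X0e; case: X00 => y; rewrite X0e.
    have Fg X y : F X -> X y -> good X.
      by move=> FX Xy; case: (Fgood _ FX) => [X0e|[]//]; move: Xy; rewrite X0e.
    right; split; last by move=> y /X0g.2 ?; exists X0.
    split; first by exists X0 => //; case: X0g.1.
    - move=> a y z [X FX Xy] [Y FY Yz].
      have [XY|YX] := Ftot _ _ FX FY.
        exists Y => //; have [_ + _] := Fg _ _ FY Yz; apply => //; exact: XY.
      exists X => //; have [_ + _] := Fg _ _ FX Xy; apply => //; exact: YX.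
    - by move=> b [X FX Xb]; have [_ _] := Fg _ _ FX Xb; exact.
  have Mn0 : M <> set0.
    move=> M0; apply: (Mmax A0); last by right; split.
    rewrite M0; split=> [//|/(_ (0, 0))]; apply.
    by exists 0; rewrite scale0r.
  case: gM => // gM; exists M; split => // B MB gB; apply: (Mmax B MB).
  by right.
have [M0 Mlin Mfun] := gM.
have Mtot v : exists b, M (v, b).
  apply: contrapT => nv.
  pose B : set (W * K^o) :=
    [set y | exists a z, M z /\ y = (a *: v + z.1, z.2)].
  apply: (Mmax B).
    split=> [[y1 y2] My|BM]; first by exists 0, (y1, y2); rewrite scale0r add0r.
    apply: nv; exists 0; apply: BM; exists 1, (0, 0); split => //=.
    by rewrite scale1r addr0.
  split; last first.
    by move=> [y1 y2] /A0M My; exists 0, (y1, y2); rewrite scale0r add0r.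
  split; first by exists 0, (0, 0); rewrite scale0r add0r.
    move=> a _ _ [b [y [My ->]]] [c [z [Mz ->]]].
    exists (a * b + c), (a *: y.1 + z.1, a *: y.2 + z.2); split; first exact: Mlin.
    by rewrite /= scalerDr scalerDl scalerA addrACA.
  move=> b [a [z [Mz [/esym/eqP E ->]]]].
  have [a0|a0] := eqVneq a 0.
    move: E; rewrite a0 scale0r add0r => /eqP z10.
    by apply: Mfun; rewrite -z10; case: (z) Mz.
  exfalso; apply: nv; exists (- a^-1 *: z.2).
  have := Mlin (- a^-1) z (0, 0) Mz M0; rewrite /= !addr0.
  suff -> : - a^-1 *: z.1 = v by [].
  move: E; rewrite addrC addr_eq0 => /eqP ->.
  by rewrite scalerN scaleNr opprK scalerA mulVf // scale1r.
pose l v := projT1 (cid (Mtot v)).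
have lP v b : M (v, b) -> b = l v.
  move=> Mb; apply/eqP; rewrite -subr_eq0; apply/eqP/Mfun.
  have := Mlin (-1) _ _ (projT2 (cid (Mtot v))) Mb.
  by rewrite /= !scaleN1r addNr [in X in M X -> _]addrC.
exists l.
  move=> a u v; apply/esym/lP.
  exact: (Mlin a _ _ (projT2 (cid (Mtot u))) (projT2 (cid (Mtot v)))).
rewrite -(lP w 1) ?oner_neq0 //.
by apply: A0M; exists 1; rewrite scale1r.
Qed.

Lemma tensor_of_seqP (t : tensor_power V n) : exists r, t = tensor_of_seq r.
Proof.
case: (t) (functional_ofP t) => /= h hP; move=> /asboolP [r hr].
by exists r; apply: val_inj; rewrite /= hr functional_of_seq.
Qed.

Lemma linear_comb (I : Type) (U W : lmodType K) (l : U -> W)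
    (h : I -> U) (r : seq (K * I)) : linear l ->
  l (\sum_(c <- r) c.1 *: h c.2) = \sum_(c <- r) c.1 *: l (h c.2).
Proof.
move=> ll; elim: r => [|c r IH]; last by rewrite !big_cons ll IH.
rewrite !big_nil; have := ll (-1) 0 0.
by rewrite scaler0 addr0 scaleN1r addNr.
Qed.

Lemma pure_tensor_multilinear : multilinear (@pure_tensor K V n).
Proof.
move=> x i a u v; apply: val_inj; apply/funext => f; exact: (svalP f).
Qed.

Lemma tensor_power_universal (W : lmodType K) (f : ('I_n -> V) -> W) :
  multilinear f ->
  exists! F : tensor_power V n -> W,
    linear F /\ forall x, F (pure_tensor x) = f x.
Proof.
move=> mf.
pose S (r : seq (K * ('I_n -> V))) := \sum_(c <- r) c.1 *: f c.2.
have SE (l : W -> K^o) (ll : linear l) r : exists h : multilinear_form V n,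
    l (S r) = functional_of (tensor_of_seq r) h.
  have mlf : multilinear (fun x => l (f x)) by move=> x i a u v; rewrite mf ll.
  exists (exist _ _ mlf); rewrite functional_of_seq fct_sumE.
  by rewrite /S (linear_comb _ _ ll); apply: eq_bigr.
have S0 r : tensor_of_seq r = 0 -> S r = 0.
  move=> r0; apply: contrapT => /eqP /separating_functional [l ll].
  by have [h ->] := SE l ll r; rewrite r0 eqxx.
have S_cat a r1 r2 :
    S ([seq (a * c.1, c.2) | c <- r1] ++ r2) = a *: S r1 + S r2.
  rewrite /S big_cat big_map scaler_sumr; congr (_ + _).
  by apply: eq_bigr => c _; rewrite scalerA.
have T_cat a r1 r2 : tensor_of_seq ([seq (a * c.1, c.2) | c <- r1] ++ r2) =
    a *: tensor_of_seq r1 + tensor_of_seq r2.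
  rewrite /tensor_of_seq big_cat big_map scaler_sumr; congr (_ + _).
  by apply: eq_bigr => c _; rewrite scalerA.
pose rep t := projT1 (cid (tensor_of_seqP t)).
have repE t : tensor_of_seq (rep t) = t.
  exact/esym/(projT2 (cid (tensor_of_seqP t))).
have FE r : S (rep (tensor_of_seq r)) = S r.
  apply/eqP; rewrite -subr_eq0 addrC -scaleN1r -S_cat; apply/eqP/S0.
  by rewrite T_cat repE scaleN1r addNr.
have pureE x : pure_tensor x = tensor_of_seq [:: (1, x)].
  by rewrite /tensor_of_seq big_seq1 scale1r.
exists (fun t => S (rep t)); split.
  split=> [a t u|x]; first by rewrite -[in LHS](repE t) -[in LHS](repE u) -T_cat FE.
  by rewrite pureE FE /S big_seq1 scale1r.
move=> F [linF Fp]; apply/funext => t.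
rewrite -[in RHS](repE t) /tensor_of_seq linear_comb //.
by apply: eq_bigr => c _; rewrite Fp.
Qed.

End TensorUniversal.

(* The scalar field, the reals or the complex numbers, with its absolute
   value taken in R. *)
Variant scalar_kind := RealScalars | ComplexScalars.

Definition scalars (R : realType) (k : scalar_kind) : numFieldType :=
  match k with
  | RealScalars => R
  | ComplexScalars => R[i]
  end.

Definition modulus (R : realType) (k : scalar_kind) : scalars R k -> R :=
  match k with
  | RealScalars => fun a : R => `|a|
  | ComplexScalars => fun z : R[i] => ComplexField.Normc.normc z
  end.

Section Modulus.
Variables (R : realType) (k : scalar_kind).
Implicit Types a b : scalars R k.

Lemma modulus_ge0 a : 0 <= modulus a.
Proof.
by case: k a => [a|[x y]] /=; rewrite ?normr_ge0 // sqrtr_ge0.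
Qed.

Lemma modulus0 : modulus (0 : scalars R k) = 0.
Proof. by case: k => /=; [exact: normr0 | exact: ComplexField.Normc.normc0]. Qed.

Lemma modulus1 : modulus (1 : scalars R k) = 1.
Proof. by case: k => /=; [exact: normr1 | exact: ComplexField.Normc.normc1]. Qed.

Lemma modulusM a b : modulus (a * b) = modulus a * modulus b.
Proof.
by case: k a b => a b; [exact: normrM | exact: ComplexField.Normc.normcM].
Qed.

End Modulus.

Section Seminorms.
Variables (R : realType) (k : scalar_kind).
Local Notation K := (scalars R k).

Definition seminorm (V : lmodType K) (p : V -> R) : Prop :=
  (forall u v, p (u + v) <= p u + p v) /\
  (forall (a : K) u, p (a *: u) = modulus a * p u).

Section SeminormTheory.
Variables (V : lmodType K) (p : V -> R).
Hypothesis sp : seminorm p.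

Lemma seminorm0 : p 0 = 0.
Proof. by rewrite -(scale0r 0) sp.2 modulus0 mul0r. Qed.

Lemma seminormN u : p (- u) = p u.
Proof.
have mN1 : modulus (-1 : K) = 1.
  have : modulus (-1 : K) ^+ 2 = 1.
    by rewrite expr2 -modulusM mulrNN mulr1 modulus1.
  by move=> /eqP; rewrite sqrf_eq1 => /orP[/eqP//|/eqP E];
    have := modulus_ge0 (-1 : K); rewrite E oppr_ge0 ler10.
by rewrite -scaleN1r sp.2 mN1 mul1r.
Qed.

Lemma seminorm_ge0 u : 0 <= p u.
Proof.
have := sp.1 u (- u).
by rewrite subrr seminorm0 seminormN -mulr2n pmulrn_lge0.
Qed.

End SeminormTheory.

Section Projective.
Variables (V : lmodType K) (n : nat).
Implicit Types (p q : V -> R) (t u : tensor_power V n).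
Local Notation reps := (seq (K * ('I_n -> V))).

Definition cost p (r : reps) : R :=
  \sum_(c <- r) modulus c.1 * \prod_(i < n) p (c.2 i).

Definition proj_seminorm p t : R :=
  inf [set cost p r | r in [set r | t = tensor_of_seq r]].

Lemma cost_ge0 p r : seminorm p -> 0 <= cost p r.
Proof.
move=> sp; apply: sumr_ge0 => c _; rewrite mulr_ge0 ?modulus_ge0 //.
by apply: prodr_ge0 => i _; exact: seminorm_ge0.
Qed.

Let costs p t : set R := [set cost p r | r in [set r | t = tensor_of_seq r]].

Let costs_has_inf p t : seminorm p -> has_inf (costs p t).
Proof.
move=> sp; split; first by have [r rE] := tensor_of_seqP t; exists (cost p r), r.
by exists 0 => _ [r _ <-]; exact: cost_ge0.
Qed.

Lemma proj_seminorm_le p r : seminorm p ->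
  proj_seminorm p (tensor_of_seq r) <= cost p r.
Proof. by move=> sp; apply: ge_inf; [exact: (costs_has_inf _ sp).2|exists r]. Qed.

Lemma le_proj_seminorm p t (b : R) :
  (forall r, t = tensor_of_seq r -> b <= cost p r) -> b <= proj_seminorm p t.
Proof.
move=> h; apply: lb_le_inf.
  by have [r rE] := tensor_of_seqP t; exists (cost p r), r.
by move=> _ [r rE <-]; exact: h.
Qed.

Lemma proj_seminorm_ge0 p t : seminorm p -> 0 <= proj_seminorm p t.
Proof. by move=> sp; apply: le_proj_seminorm => r _; exact: cost_ge0. Qed.

Lemma proj_seminorm_seminorm p : seminorm p -> seminorm (proj_seminorm p).
Proof.
move=> sp; split=> [t u|a t].
  rewrite -lerBlDr; apply: le_proj_seminorm => r rE.
  rewrite lerBlDr -lerBlDl; apply: le_proj_seminorm => s sE.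
  rewrite lerBlDl rE sE.
  have -> : tensor_of_seq r + tensor_of_seq s = tensor_of_seq (r ++ s).
    by rewrite /tensor_of_seq big_cat.
  by apply: (le_trans (proj_seminorm_le _ sp)); rewrite /cost big_cat.
have le_scale (b : K) v :
    proj_seminorm p (b *: v) <= modulus b * proj_seminorm p v.
  pose sc r : reps := [seq (b * c.1, c.2) | c <- r].
  have scE r : b *: tensor_of_seq r = tensor_of_seq (sc r).
    rewrite /tensor_of_seq big_map scaler_sumr.
    by apply: eq_bigr => c _; rewrite scalerA.
  have costE r : cost p (sc r) = modulus b * cost p r.
    rewrite /cost big_map mulr_sumr.
    by apply: eq_bigr => c _; rewrite modulusM mulrA.
  have [b0|b0] := eqVneq (modulus b) 0.
    have [r rE] := tensor_of_seqP v; rewrite rE scE.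
    by apply: (le_trans (proj_seminorm_le _ sp)); rewrite costE b0 !mul0r.
  have bgt0 : 0 < modulus b by rewrite lt_neqAle eq_sym b0 modulus_ge0.
  rewrite -ler_pdivrMl //; apply: le_proj_seminorm => r ->.
  by rewrite ler_pdivrMl // scE -costE; exact: proj_seminorm_le.
apply/le_anti; rewrite le_scale /=.
have [->|a0] := eqVneq a 0.
  by rewrite modulus0 mul0r; exact: proj_seminorm_ge0.
have := le_scale a^-1 (a *: t); rewrite scalerA mulVf // scale1r.
move=> /(ler_wpM2l (modulus_ge0 a)).
by rewrite mulrA -modulusM mulfV // modulus1 mul1r.
Qed.

Lemma proj_seminorm_mono p q t : seminorm p -> seminorm q ->
  (forall v, p v <= q v) -> proj_seminorm p t <= proj_seminorm q t.
Proof.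
move=> sp sq pq; apply: le_proj_seminorm => r ->.
apply: (le_trans (proj_seminorm_le _ sp)); apply: ler_sum => c _.
rewrite ler_wpM2l ?modulus_ge0 //; apply: ler_prod => i _.
by rewrite pq andbT; exact: seminorm_ge0.
Qed.

End Projective.

Definition continuous_seminorm (g : tvsType K) (p : g -> R) : Prop :=
  seminorm p /\ continuous p.

Section ProjectiveTopology.
Variables (g : tvsType K) (n : nat).
Local Notation S := (sym_power g n).
Implicit Types (p q : g -> R) (t u : S).

Definition sym_seminorm p t : R := proj_seminorm p (tensor_of t).

Lemma sym_seminorm_seminorm p : seminorm p -> seminorm (sym_seminorm p).
Proof.
move=> sp; have [sub hom] := proj_seminorm_seminorm n sp.
by split=> [t u|a t]; [exact: sub | exact: hom].
Qed.

Definition proj_entourage : set_system (S * S) :=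
  [set E | exists p (e : R), [/\ continuous_seminorm p, 0 < e
     & [set z | sym_seminorm p (z.1 - z.2) < e] `<=` E]].

Lemma continuous_seminorm0 : continuous_seminorm (cst 0 : g -> R).
Proof.
split; first by split=> [u v|a u]; rewrite ?addr0 ?mulr0.
by move=> x; exact: cvg_cst.
Qed.

Lemma continuous_seminormD p q : continuous_seminorm p ->
  continuous_seminorm q -> continuous_seminorm (fun x => p x + q x).
Proof.
move=> [sp cp] [sq cq]; split; last by move=> x; apply: cvgD; [exact: cp|exact: cq].
split=> [u v|a u]; last by rewrite sp.2 sq.2 mulrDr.
by rewrite addrACA; apply: lerD; [exact: sp.1|exact: sq.1].
Qed.

Lemma proj_entourage_filter : Filter proj_entourage.
Proof.
split.
- by exists (cst 0), 1; split => //; exact: continuous_seminorm0.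
- move=> E F [p [e [cp e0 pE]]] [q [d [cq d0 qF]]].
  have cpq := continuous_seminormD cp cq.
  exists (fun x => p x + q x), (Num.min e d); split=> //.
    by rewrite lt_min e0 d0.
  move=> z /=; rewrite lt_min => /andP[ze zd]; split.
    apply/pE/(le_lt_trans _ ze)/proj_seminorm_mono; [exact: cp.1|exact: cpq.1|].
    by move=> v; rewrite lerDl; exact: (seminorm_ge0 cq.1).
  apply/qF/(le_lt_trans _ zd)/proj_seminorm_mono; [exact: cq.1|exact: cpq.1|].
  by move=> v; rewrite lerDr; exact: (seminorm_ge0 cp.1).
- by move=> E F EF [p [e [cp e0 pE]]]; exists p, e; split=> // z /pE /EF.
Qed.

Lemma proj_entourage_diagonal E : proj_entourage E -> diagonal `<=` E.
Proof.
move=> [p [e [cp e0 pE]]] [t u] /diagonalP /= ->; apply: pE => /=.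
by rewrite subrr (seminorm0 (sym_seminorm_seminorm cp.1)).
Qed.

Lemma proj_entourage_inv E :
  proj_entourage E -> proj_entourage E^-1%relation.
Proof.
move=> [p [e [cp e0 pE]]]; exists p, e; split => // -[t u] /= tu.
by apply: pE => /=; rewrite -(seminormN (sym_seminorm_seminorm cp.1)) opprB.
Qed.

Lemma proj_entourage_split E : proj_entourage E ->
  exists2 F, proj_entourage F & (F \; F)%relation `<=` E.
Proof.
move=> [p [e [cp e0 pE]]].
exists [set z | sym_seminorm p (z.1 - z.2) < e / 2].
  by exists p, (e / 2); split => //; rewrite divr_gt0.
move=> [t u] /= [v /= tv vu]; apply: pE => /=.
rewrite -(subrKA v) (splitr e).
exact: (le_lt_trans ((sym_seminorm_seminorm cp.1).1 _ _) (ltrD tv vu)).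
Qed.

HB.instance Definition _ := isUniform.Build (sym_power g n)
  proj_entourage_filter proj_entourage_diagonal proj_entourage_inv
  proj_entourage_split.

End ProjectiveTopology.
End Seminorms.

Section Completion.
Variable T : uniformType.

(* The Hausdorff completion as the set of minimal Cauchy filters (Bourbaki,
   General Topology II.3.7). *)
Record completion := Completion {
  cfilter : set_system T;
  cfilter_proper : ProperFilter cfilter;
  cfilter_cauchy : cauchy cfilter;
  cfilter_minimal : forall F : set_system T,
    ProperFilter F -> cauchy F -> F `<=` cfilter -> cfilter `<=` F }.

Lemma nbhs_cauchy (x : T) : cauchy (nbhs x).
Proof.
move=> E /entourage_split_ex [F entF FFE].
exists (xsection F^-1%relation x, xsection F x) => [|[u v] /= []].
  by split; apply: nbhs_entourage => //; exact: entourage_inv.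
by move=> /xsectionP xu /xsectionP xv; apply: FFE; exists x.
Qed.

Lemma nbhs_minimal (x : T) (F : set_system T) :
  ProperFilter F -> cauchy F -> F `<=` nbhs x -> nbhs x `<=` F.
Proof.
move=> FF cF Fx A /nbhsP [E entE EA].
have [[P Q] /= [FP FQ] PQE] := cF _ entE.
apply: filterS FQ => y Qy; apply/EA/xsectionP/(PQE (x, y)); split=> //=.
exact: nbhs_singleton (Fx _ FP).
Qed.

Definition to_completion (x : T) : completion :=
  Completion (nbhs_pfilter x) (@nbhs_cauchy x) (@nbhs_minimal x).

Section Extension.
Variables (R : realType) (f : T -> R).

Definition extension (x : completion) : R := lim (f @ cfilter x).

Lemma extension_cvg x : unif_continuous f -> f @ cfilter x --> extension x.
Proof.
move=> uf; have FF := cfilter_proper x; apply: cauchy_cvg => E /uf entE.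
have [[P Q] /= [FP FQ] PQE] := cfilter_cauchy x entE.
exists (f @` P, f @` Q).
  by split; [apply: filterS FP|apply: filterS FQ] => y yP; exists y.
by move=> [_ _] /= [[u Pu <-] [v Qv <-]]; exact: (PQE (u, v)).
Qed.

Lemma extension_to_completion x :
  unif_continuous f -> extension (to_completion x) = f x.
Proof.
move=> uf; apply: cvg_lim => //.
apply/cvg_entourageP => E /uf entE.
have := nbhs_entourage x entE.
by apply: filterS => y /xsectionP.
Qed.

End Extension.
End Completion.

Section LieAlgebra.
Variables (R : realType) (k : scalar_kind) (g : tvsType (scalars R k)).
Variable br : {bilinear g -> g -> g}.

Definition lie_bracket : Prop :=
  (forall x, br x x = 0) /\
  (forall x y z, br x (br y z) + br y (br z x) + br z (br x y) = 0).

(* [bracket_word s w]: w is obtained from the entries of s, in this order, by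
   size s - 1 brackets placed in some way. *)
Inductive bracket_word : seq g -> g -> Prop :=
  | word_letter x : bracket_word [:: x] x
  | word_bracket s t u v : bracket_word s u -> bracket_word t v ->
      bracket_word (s ++ t) (br u v).

Definition asymptotic_estimate (p q : g -> R) : Prop :=
  forall s w, bracket_word s w -> p w <= \prod_(x <- s) q x.

Definition AE_Lie_algebra : Prop :=
  [/\ hausdorff_space g,
      lie_bracket,
      continuous (fun z : g * g => br z.1 z.2) &
      forall p : g -> R, continuous_seminorm p ->
        exists2 q, continuous_seminorm q & asymptotic_estimate p q].

End LieAlgebra.

Section SymmetricAlgebra.
Variables (R : realType) (k : scalar_kind) (g : tvsType (scalars R k)).

Lemma sym_seminorm_unif_continuous n (p : g -> R) :
  continuous_seminorm p -> unif_continuous (@sym_seminorm R k g n p).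
Proof.
move=> cp E; rewrite -entourage_ballE => -[e /= e0 eE].
exists p, e; split => // -[t u] /= tu; apply: eE.
rewrite /ball /= (le_lt_trans _ tu) //.
have [sub hom] := sym_seminorm_seminorm n cp.1.
have Nu := seminormN (sym_seminorm_seminorm n cp.1).
rewrite ler_norml lerBlDr lerNl opprB lerBlDr; apply/andP; split.
  by rewrite -(opprB u t) Nu -{1}(subrK t u) sub.
by rewrite -{1}(subrK u t) sub.
Qed.

Lemma extension_sym_seminorm n (p : g -> R) (t : sym_power g n) :
  continuous_seminorm p ->
  extension (sym_seminorm p) (to_completion t) = sym_seminorm p t.
Proof.
by move=> cp; apply: extension_to_completion; exact: sym_seminorm_unif_continuous.
Qed.

Definition formal_series : Type := forall n, completion (sym_power g n).

Definition weighted_seminorm (p : g -> R) (r : R) (x : formal_series) : \bar R :=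
  (\sum_(0 <= n <oo)
     ((n`!%:R `^ r) * extension (sym_seminorm p) (x n))%:E)%E.

Definition completed_sym_algebra (r : R) : set formal_series :=
  [set x | forall p, continuous_seminorm p ->
             (weighted_seminorm p r x < +oo)%E].

Definition exp_series (xi : g) : formal_series :=
  fun n => to_completion (n`!%:R^-1 *: sym_pow n xi).

End SymmetricAlgebra.

(* Main.v *)
Require Import Defs.
From mathcomp Require Import all_boot all_order all_algebra.
From mathcomp Require Import complex lra ring.
From mathcomp Require Import all_classical all_reals all_analysis.

Set Implicit Arguments.
Unset Strict Implicit.
Unset Printing Implicit Defensive.

Import Order.TTheory GRing.Theory Num.Theory.
Import numFieldNormedType.Exports.

Local Open Scope classical_set_scope.
Local Open Scope ring_scope.

(* Since [g] is Hausdorff and locally convex, some continuous seminorm [p] has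
   [1 <= p xi].  By Hahn-Banach there is a linear functional [f] with
   [|f| <= p] and [|f xi| = p xi]; testing tensors against its [n]-fold product
   shows that the projective seminorm of [xi^n] is at least [p xi ^ n >= 1].
   The [n]-th term of [p_R (exp xi)] is then at least [n!^R / n! >= 1], and the
   series diverges. *)

(** * Real scalars inside the field *)

Section RealScalars.
Variables (R : realType) (k : scalar_kind).
Local Notation K := (scalars R k).

Definition of_real : R -> K :=
  match k with
  | RealScalars => fun a => a
  | ComplexScalars => fun a => a%:C%C
  end.

Lemma of_realD : {morph of_real : a b / a + b}.
Proof. by rewrite /of_real; case: k => a b //; rewrite rmorphD. Qed.

Lemma of_realM : {morph of_real : a b / a * b}.
Proof. by rewrite /of_real; case: k => a b //; rewrite rmorphM. Qed.

Lemma of_real1 : of_real 1 = 1.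
Proof. by rewrite /of_real; case: k. Qed.

Lemma of_real0 : of_real 0 = 0.
Proof. by rewrite /of_real; case: k. Qed.

Lemma of_realN : {morph of_real : a / - a}.
Proof. by rewrite /of_real; case: k => a //; rewrite rmorphN. Qed.

Lemma of_realV : {morph of_real : a / a^-1}.
Proof. by rewrite /of_real; case: k => a //; rewrite fmorphV. Qed.

Lemma of_real_nat n : of_real n%:R = n%:R.
Proof. by rewrite /of_real; case: k => //; rewrite rmorph_nat. Qed.

Lemma modulus_of_real a : modulus (of_real a) = `|a|.
Proof. by rewrite /of_real; case: k => //=; rewrite expr0n addr0 sqrtr_sqr. Qed.

Lemma ler_of_real : {mono of_real : a b / a <= b}.
Proof. by rewrite /of_real; case: k => a b //; rewrite lecR. Qed.

Lemma ltr_of_real : {mono of_real : a b / a < b}.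
Proof. by rewrite /of_real; case: k => a b //; rewrite ltcR. Qed.

(** The norm on [K] takes its values in [K] itself; this identity moves topological estimates to
    [R]. *)
Lemma normr_modulus (a : K) : `|a| = of_real (modulus a).
Proof. by rewrite /of_real; case: k a. Qed.

End RealScalars.

(** * Dominated extension of real-linear functionals *)

Section HahnBanach.
Variables (R : realType) (k : scalar_kind) (V : lmodType (scalars R k)).
Variable p : V -> R.
Hypothesis sp : seminorm p.
Local Notation of_real := (@of_real R k).

(** Partial functionals are encoded as graphs, so that a chain is joined by plain union;
    single-valuedness follows from domination. *)
Let good (A : set (V * R)) := [/\ A (0, 0),
  forall a y z, A y -> A z -> A (of_real a *: y.1 + z.1, a * y.2 + z.2)
  & forall y, A y -> y.2 <= p y.1].

Lemma seminorm_of_real a v : p (of_real a *: v) = `|a| * p v.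
Proof. by rewrite sp.2 modulus_of_real. Qed.

(** Domination bounds both [b] and [- b] by [p 0 = 0]. *)
Let good_ker A b : good A -> A (0, b) -> b = 0.
Proof.
move=> [A0 Alin Ap] Ab.
have b0 := Ap _ Ab; have Nb0 := Ap _ (Alin (-1) _ _ Ab A0).
by move: b0 Nb0; rewrite /= scaler0 !addr0 (seminorm0 sp); lra.
Qed.

(* The value given to [v] is a supremum lying below all the upper bounds that
   domination by [p] imposes. *)
Let good_extend A v : good A ->
  exists B, [/\ good B, A `<=` B & exists b, B (v, b)].
Proof.
move=> gA; have [A0 Alin Ap] := gA.
pose L := [set y.2 - p (y.1 - v) | y in A].
have Lub z : A z -> ubound L (p (z.1 + v) - z.2).
  move=> Az _ [y Ay <-].
  have := Ap _ (Alin 1 _ _ Ay Az); rewrite /= of_real1 scale1r mul1r.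
  have := sp.1 (y.1 - v) (z.1 + v); rewrite addrACA addNr addr0.
  lra.
have L0 : L !=set0 by exists (0 - p (0 - v)), (0, 0).
have Lsup : has_sup L.
  by split=> //; exists (p (0 + v) - 0); exact: (Lub (0, 0)).
pose c := sup L.
have c_le z : A z -> c <= p (z.1 + v) - z.2.
  by move=> Az; apply: ge_sup => //; exact: Lub.
have le_c y : A y -> y.2 - p (y.1 - v) <= c.
  by move=> Ay; apply: ub_le_sup; [exact: Lsup.2 | exists y].
exists [set y | exists a z, A z /\
  y = (of_real a *: v + z.1, a * c + z.2)]; split; last 2 first.
- by move=> [y b] Ay; exists 0, (y, b); rewrite of_real0 scale0r mul0r !add0r.
- by exists c, 1, (0, 0); rewrite of_real1 scale1r mul1r !addr0.
split.
- by exists 0, (0, 0); rewrite of_real0 scale0r mul0r !addr0.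
- move=> a _ _ [b [y [Ay ->]]] [d [z [Az ->]]] /=.
  exists (a * b + d), (of_real a *: y.1 + z.1, a * y.2 + z.2).
  split; first exact: Alin.
  rewrite /= of_realD of_realM scalerDr scalerDl scalerA addrACA.
  by congr pair; lra.
move=> _ [a [z [Az ->]]] /=.
have Az' b : A (of_real b *: z.1, b * z.2).
  by have := Alin b _ _ Az A0; rewrite /= !addr0.
have [->|a_neq0] := eqVneq a 0.
  by rewrite of_real0 scale0r mul0r !add0r; exact: Ap.
(* With [b = |a|], homogeneity reduces domination to a point [z' - v] or [z' + v], where it is one
   of the two bounds on [c]. *)
have sE (b : R) : 0 < b ->
    p (of_real a *: v + z.1) =
    b * p (of_real b^-1 *: z.1 + of_real (a / b) *: v).
  move=> b0; rewrite -[X in X * _]gtr0_norm // -seminorm_of_real scalerDr.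
  rewrite !scalerA -!of_realM mulfV ?gt_eqF // of_real1 scale1r addrC.
  by rewrite mulrC divfK ?gt_eqF.
have [a0|a0|a0] := ltgtP a 0; last by rewrite a0 eqxx in a_neq0.
- have Na0 : 0 < - a by rewrite oppr_gt0.
  rewrite (sE (- a)) //.
  rewrite invrN mulrN divff // (of_realN _ 1) of_real1 scaleN1r.
  have := le_c _ (Az' (- a^-1)); rewrite /= -(ler_pM2l Na0).
  rewrite mulrBr mulrA mulrNN divff // mul1r; lra.
rewrite (sE a) //.
rewrite divff // of_real1 scale1r.
have := c_le _ (Az' a^-1); rewrite /= -(ler_pM2l a0).
rewrite mulrBr mulrA divff // mul1r; lra.
Qed.

(** Zorn's lemma applies to dominated graphs containing the line through [w]; a maximal one is total
    by [good_extend]. Over the complex field, [f] is only real-linear. *)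
Lemma real_hahn_banach w : exists2 f : V -> R,
  forall a u v, f (of_real a *: u + v) = a * f u + f v &
  f w = p w /\ forall v, f v <= p v.
Proof.
pose A0 : set (V * R) := [set y | exists a, y = (of_real a *: w, a * p w)].
have gA0 : good A0.
  split; first by exists 0; rewrite of_real0 scale0r mul0r.
  - move=> a _ _ [b ->] [c ->]; exists (a * b + c) => /=.
    by rewrite of_realD of_realM scalerDl scalerA mulrDl mulrA.
  - move=> _ [a ->] /=; rewrite seminorm_of_real ler_wpM2r ?ler_norm //.
    exact: seminorm_ge0 sp _.
have [|M [gM Mmax]] :=
    @Zorn_bigcup _ [set A | A = set0 \/ (good A /\ A0 `<=` A)].
  move=> F Fgood Ftot.
  have [Fe|] := pselect (forall X, F X -> X = set0).
    by left; rewrite -subset0 => y [X FX]; rewrite (Fe _ FX).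
  move=> /existsNP [X0 /not_implyP [FX0 /eqP/set0P X00]].
  have Fg X y : F X -> X y -> good X /\ A0 `<=` X.
    by move=> FX Xy; case: (Fgood _ FX) => // X0e; move: Xy; rewrite X0e.
  have [z0 X0z0] := X00; have [X0g X0A0] := Fg _ _ FX0 X0z0.
  right; split; last by move=> y /X0A0 ?; exists X0.
  split; first by exists X0 => //; case: X0g.
  - move=> a y z [X FX Xy] [Y FY Yz].
    have [XY|YX] := Ftot _ _ FX FY.
      exists Y => //; have [[_ + _] _] := Fg _ _ FY Yz; apply => //; exact: XY.
    exists X => //; have [[_ + _] _] := Fg _ _ FX Xy; apply => //; exact: YX.
  - by move=> y [X FX Xy]; have [[_ _ +] _] := Fg _ _ FX Xy; exact.
have {}gM : good M /\ A0 `<=` M.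
  case: gM => // M0; exfalso; apply: (Mmax A0); last by right; split.
  rewrite M0; split=> [//|/(_ (0, 0))]; apply.
  by exists 0; rewrite of_real0 scale0r mul0r.
case: gM => gM A0M; have [M0 Mlin Mp] := gM.
have Mtot v : exists b, M (v, b).
  have [B [gB MB [b Bvb]]] := good_extend v gM.
  exists b; apply: contrapT => nM; apply: (Mmax B).
    by split=> // BM; apply: nM; exact: BM.
  by right; split=> // y /A0M /MB.
have [f Mf] := choice Mtot.
have fE v b : M (v, b) -> f v = b.
  move=> Mb; apply/eqP; rewrite -subr_eq0 addrC; apply/eqP/(good_ker gM).
  have := Mlin (-1) _ _ Mb (Mf v).
  by rewrite /= of_realN of_real1 scaleN1r addNr mulN1r.
exists f.
  by move=> a u v; apply: fE; exact: (Mlin a _ _ (Mf u) (Mf v)).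
split; last by move=> v; exact: (Mp _ (Mf v)).
by apply/fE/A0M; exists 1; rewrite of_real1 scale1r mul1r.
Qed.

End HahnBanach.

(** * From real to complex functionals *)

Section Complexification.
Local Open Scope complex_scope.
Variables (R : realType) (V : lmodType R[i]) (f : V -> R).
Hypothesis flin : forall (a : R) u v, f (a%:C *: u + v) = a * f u + f v.

(** The only possible complex-linear functional with real part [f]: its value at ['i *: v] forces
    the imaginary part. *)
Definition complexify v : R[i] := f v +i* - f ('i *: v).

Lemma complexify_linear : linear (complexify : V -> R[i]^o).
Proof.
have fD u v : f (u + v) = f u + f v.
  by have := flin 1 u v; rewrite scale1r mul1r.
have f0 : f 0 = 0 by have := fD 0 0; rewrite addr0; lra.
have fZ a v : f (a%:C *: v) = a * f v.
  by have := flin a v 0; rewrite !addr0 f0 addr0.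
move=> [a b] u v.
have -> : a +i* b = a%:C + b%:C * 'i by simpc.
rewrite /complexify scalerDr scalerA.
have -> : 'i * (a%:C + b%:C * 'i) = (- b)%:C + a%:C * 'i :> R[i] by simpc.
rewrite !scalerDl -!scalerA !fD !fZ -[_ *: (_ +i* _)]/(_ * _); simpc.
by apply/eqP; rewrite eq_complex /=; apply/andP; split; apply/eqP; ring.
Qed.

(* A unit scalar rotates each value of [complexify] onto the positive real
   axis, where it is a value of [f]. *)
Lemma complexify_le (p : V -> R) v :
  (forall (a : R[i]) u, p (a *: u) = ComplexField.Normc.normc a * p u) ->
  (forall u, f u <= p u) -> 0 <= p v ->
  ComplexField.Normc.normc (complexify v) <= p v.
Proof.
move=> pZ fp pv0; set m := ComplexField.Normc.normc _.
have [->//|m0] := eqVneq m 0.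
have Fv0 : complexify v != 0.
  by apply: contra_neq m0; rewrite /m => ->; exact: ComplexField.Normc.normc0.
have m_ge0 : 0 <= m.
  by rewrite /m; case: (complexify v) => ? ?; exact: sqrtr_ge0.
pose a := m%:C / complexify v.
have am : ComplexField.Normc.normc a = 1.
  rewrite ComplexField.Normc.normcM ComplexField.Normc.normcV -/m.
  by rewrite /= expr0n addr0 sqrtr_sqr ger0_norm ?mulfV.
have F0 : complexify 0 = 0.
  by have := complexify_linear (-1) 0 0; rewrite scaler0 addr0 scaleN1r addNr.
have := complexify_linear a v 0; rewrite F0 !addr0.
rewrite -[a *: complexify v]/(a * _) divfK //.
move=> /(congr1 (@complex.Re R)) /= <-.
by rewrite (le_trans (fp _)) // pZ am mul1r.
Qed.

End Complexification.

Lemma hahn_banach (R : realType) (k : scalar_kind)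
    (V : lmodType (scalars R k)) (p : V -> R) (w : V) : seminorm p ->
  exists2 f : V -> (scalars R k)^o, linear f &
    modulus (f w) = p w /\ forall v, modulus (f v) <= p v.
Proof.
move=> sp; have [f flin [fw fp]] := real_hahn_banach sp w.
have p0 := seminorm_ge0 sp.
case: k V p w sp f flin fw fp p0 => V p w sp f flin fw fp p0.
  exists f; first exact: flin.
  split=> [|v]; first by rewrite /= fw ger0_norm.
  rewrite /= ler_norml fp andbT lerNl -(seminormN sp).
  have f0 : f 0 = 0 by have := flin (-1) 0 0; rewrite scaler0 addr0; lra.
  have := flin (-1) v 0; rewrite /= scaleN1r addr0 f0 => E.
  by rewrite (le_trans _ (fp (- v))) // E; lra.
have Fp v := @complexify_le R V f flin p v sp.2 fp (p0 v).
exists (complexify f); first exact: complexify_linear flin.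
split=> //; apply/eqP; rewrite eq_le; apply/andP; split; first exact: Fp.
(* The modulus at [w] is at least the real part, which is [f w = p w]. *)
rewrite -fw /= (le_trans (ler_norm _)) // -sqrtr_sqr.
by rewrite ler_sqrt ?addr_ge0 ?sqr_ge0 // lerDl sqr_ge0.
Qed.

(** * Projective seminorms of diagonal tensors *)

Lemma modulus_prod (R : realType) (k : scalar_kind) (I : Type) (s : seq I)
    (F : I -> scalars R k) :
  modulus (\prod_(i <- s) F i) = \prod_(i <- s) modulus (F i).
Proof. by apply: (big_morph _ (@modulusM R k)); exact: modulus1. Qed.

Lemma le_modulusD (R : realType) (k : scalar_kind) (a b : scalars R k) :
  modulus (a + b) <= modulus a + modulus b.
Proof. by case: k a b => a b; [exact: ler_normD | exact: le_normcD]. Qed.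

Section PureTensor.
Variables (R : realType) (k : scalar_kind) (V : lmodType (scalars R k)).
Local Notation K := (scalars R k).

Lemma multilinear_prod (n : nat) (f : V -> K^o) : linear f ->
  multilinear (fun x : 'I_n -> V => \prod_i f (x i) : K^o).
Proof.
move=> flin x i a u v.
have E w : \prod_j f (dfwith x i w j) = f w * \prod_(j | j != i) f (x j).
  rewrite (bigD1 i) //= dfwithin; congr (_ * _).
  by apply: eq_bigr => j ji; rewrite dfwithout // eq_sym.
by rewrite !E flin mulrDl -[a *: f u]/(a * f u) -mulrA.
Qed.

(* Products of functionals dominated by [p] are multilinear forms bounded by
   the projective seminorm. *)
Lemma proj_seminorm_diag_ge (p : V -> R) (n : nat) (v : V) : seminorm p ->
  p v ^+ n <= proj_seminorm p (pure_tensor (fun _ : 'I_n => v)).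
Proof.
move=> sp; have [f flin [fv fp]] := hahn_banach v sp.
apply: le_proj_seminorm => r /(congr1 (@functional_of _ _ _)).
rewrite functional_of_seq fct_sumE.
(* Tensors are functionals on multilinear forms, so their equality can be evaluated at the product
   form of [f]. *)
move=> /(congr1 (@^~ (exist _ _ (@multilinear_prod n f flin)))) /= E.
have -> : p v ^+ n = modulus (\prod_(i < n) f v).
  by rewrite modulus_prod fv prodr_const card_ord.
rewrite [X in modulus X]E /cost; elim: r {E} => [|c r IH].
  by rewrite !big_nil modulus0.
rewrite !big_cons (le_trans (le_modulusD _ _)) // lerD //.
rewrite modulusM ler_wpM2l ?modulus_ge0 // modulus_prod.
by apply: ler_prod => i _; rewrite modulus_ge0 fp.
Qed.

End PureTensor.

(** * Minkowski functionals *)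

Section Gauge.
Variables (R : realType) (k : scalar_kind) (V : lmodType (scalars R k)).
Local Notation K := (scalars R k).
Local Notation of_real := (@of_real R k).
Variable B : set V.
Hypothesis B_balanced : forall (a : K) x, modulus a <= 1 -> B x -> B (a *: x).
Hypothesis B_convex : forall (s t : R) x y, 0 <= s -> 0 <= t -> s + t = 1 ->
  B x -> B y -> B (of_real s *: x + of_real t *: y).
Hypothesis B_absorbing : forall x, exists2 t : R, 0 < t & B (of_real t^-1 *: x).

(** The condition [0 < t] also shuts out the convention [0^-1 = 0], which would always admit
    [t = 0]. *)
Definition gauge x : R := inf [set t : R | 0 < t /\ B (of_real t^-1 *: x)].

Lemma gauge_le t x : 0 < t -> B (of_real t^-1 *: x) -> gauge x <= t.
Proof.
by move=> t0 Bt; apply: ge_inf => //; exists 0 => s [/ltW].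
Qed.

(** Absorption makes the set nonempty, so [inf] is a true infimum and not a default value. *)
Lemma le_gauge b x :
  (forall t, 0 < t -> B (of_real t^-1 *: x) -> b <= t) -> b <= gauge x.
Proof.
move=> h; apply: lb_le_inf; first by have [t t0 Bt] := B_absorbing x; exists t.
by move=> t [t0 Bt]; exact: h.
Qed.

Lemma gauge_ge0 x : 0 <= gauge x.
Proof. by apply: le_gauge => t /ltW. Qed.

(** If [t < 1] were admissible, scaling by [t] would bring [x] into the balanced set [B]. *)
Lemma gauge_ge1 x : ~ B x -> 1 <= gauge x.
Proof.
move=> nBx; apply: le_gauge => t t0 Bt; rewrite leNgt; apply/negP => t1.
apply: nBx; have := B_balanced (a := of_real t) _ Bt.
rewrite scalerA -of_realM mulfV ?gt_eqF // of_real1 scale1r; apply.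
by rewrite modulus_of_real gtr0_norm // ltW.
Qed.

Lemma gauge_seminorm : seminorm gauge.
Proof.
have le_scale (a : K) x : gauge (a *: x) <= modulus a * gauge x.
  have := modulus_ge0 a; rewrite le_eqVlt => /orP[/eqP a0|a0].
    rewrite -a0 mul0r; apply/ler_addgt0Pl => t t0; rewrite addr0.
    apply: gauge_le => //; have [s s0 Bs] := B_absorbing x.
    have -> : of_real t^-1 *: (a *: x) =
        (of_real (t^-1 * s) * a) *: (of_real s^-1 *: x).
      rewrite !scalerA of_realM; congr (_ *: _).
      rewrite mulrAC -(mulrA _ (of_real s)) -of_realM.
      by rewrite mulfV ?gt_eqF // of_real1 mulr1.
    by apply: B_balanced => //; rewrite modulusM -a0 mulr0.
  rewrite -ler_pdivrMl //; apply: le_gauge => t t0 Bt; rewrite ler_pdivrMl //.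
  apply: gauge_le; first exact: mulr_gt0.
  (* The factor [a / |a|] has modulus 1, so balancedness removes it. *)
  have -> : of_real (modulus a * t)^-1 *: (a *: x) =
      (of_real (modulus a)^-1 * a) *: (of_real t^-1 *: x).
    by rewrite !scalerA invfM of_realM mulrAC.
  apply: B_balanced => //; rewrite modulusM modulus_of_real.
  by rewrite gtr0_norm ?invr_gt0 // mulVf // gt_eqF.
split=> [x y|a x]; last first.
  apply/le_anti; rewrite le_scale /=.
  have [->|a0] := eqVneq a 0; first by rewrite modulus0 mul0r gauge_ge0.
  have := le_scale a^-1 (a *: x); rewrite scalerA mulVf // scale1r.
  move=> /(ler_wpM2l (modulus_ge0 a)).
  by rewrite mulrA -modulusM mulfV // modulus1 mul1r.
rewrite -lerBlDr; apply: le_gauge => s s0 Bs.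
rewrite lerBlDr -lerBlDl; apply: le_gauge => t t0 Bt; rewrite lerBlDl.
have st0 : 0 < s + t by exact: addr_gt0.
apply: gauge_le => //.
(* A convex combination of the points [x / s] and [y / t] of [B]. *)
have -> : of_real (s + t)^-1 *: (x + y) =
   of_real (s / (s + t)) *: (of_real s^-1 *: x) +
   of_real (t / (s + t)) *: (of_real t^-1 *: y).
  rewrite !scalerA -!of_realM scalerDr; congr (of_real _ *: _ + of_real _ *: _).
    by rewrite mulrAC mulfV ?mul1r // gt_eqF.
  by rewrite mulrAC mulfV ?mul1r // gt_eqF.
apply: B_convex => //; [exact/divr_ge0/ltW/st0/ltW|exact/divr_ge0/ltW/st0/ltW|].
by rewrite -mulrDl mulfV // gt_eqF.
Qed.

End Gauge.

(** * Continuous seminorms from convex neighbourhoods *)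

Section SeparatingSeminorm.
Variables (R : realType) (k : scalar_kind) (g : tvsType (scalars R k)).
Local Notation K := (scalars R k).
Local Notation of_real := (@of_real R k).

(** The bound [|p x - p y| <= p (x - y)] carries smallness near 0 to every point. *)
Lemma seminorm_continuous (p : g -> R) : seminorm p ->
  (forall e : R, 0 < e -> \forall z \near (0 : g), p z <= e) -> continuous p.
Proof.
move=> sp p0 x; apply/cvgrPdist_le => e /p0 pe.
have shift : (fun y : g => x - y) @ x --> (0 : g).
  rewrite -(subrr x).
  have c : (fun y : g => (x, - y)) @ x --> (x, - x).
    by apply: cvg_pair; [exact: cvg_cst | exact: opp_continuous].
  exact: (cvg_comp _ _ c (@add_continuous g (x, - x))).
have := shift _ pe; rewrite nbhs_simpl /=; apply: filterS => y py.
rewrite (le_trans _ py) // ler_norml lerNl opprB !lerBlDr.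
have sub u v : p u <= p (u - v) + p v by rewrite -{1}(subrK v u) sp.1.
by rewrite sub andbT -(opprB y x) (seminormN sp) sub.
Qed.

(** Scaling is jointly continuous at [(0, x)]. This makes the balanced core of [U] absorbing and,
    for [x = 0], a neighbourhood of 0. *)
Lemma scale_small (x : g) (U : set g) : nbhs (0 : g) U ->
  exists2 d : R, 0 < d &
    \forall z \near x, forall a : K, modulus a <= d -> U (a *: z).
Proof.
move=> U0; have := @scale_continuous _ g (0, x) U; rewrite /= scale0r.
move=> /(_ U0) [[P Q] /= [[e /= e0 eP] Qx] PQU].
have eE : e = of_real (modulus e) by rewrite -normr_modulus gtr0_norm.
have m0 : 0 < modulus e by move: e0; rewrite {1}eE -(of_real0 R k) ltr_of_real.
(* Halving passes from the strict inequality of the ball to [modulus a <= d]. *)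
exists (modulus e / 2); first by rewrite divr_gt0.
apply: filterS Qx => z Qz a ad; apply: (PQU (a, z)); split=> //.
apply: eP; rewrite /ball_ /= sub0r normrN normr_modulus eE ltr_of_real.
by rewrite (le_lt_trans ad) // gtr_pMr // invf_lt1 // ltr1n.
Qed.

(** Convexity in a [tvsType] has weights in [K] between 0 and 1; here they become real. *)
Lemma locally_convex_nbhs0 (A : set g) : nbhs (0 : g) A ->
  exists U : set g, [/\ nbhs (0 : g) U, U `<=` A &
    forall (s t : R) x y, 0 <= s -> 0 <= t -> s + t = 1 ->
    U x -> U y -> U (of_real s *: x + of_real t *: y)].
Proof.
move=> A0; have [C Ccvx [Copen Cb]] := @locally_convex _ g.
have [U [CU U0] UA] := Cb 0 A A0; exists U; split=> //.
  exact: (open_nbhs_nbhs (conj (Copen _ CU) U0)).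
move=> s t x y s0 t0 st /mem_set Ux /mem_set Uy.
have os0 : 0 <= of_real s by rewrite -(of_real0 R k) ler_of_real.
have os1 : of_real s <= 1 by rewrite -(of_real1 R k) ler_of_real -st lerDl.
have := Ccvx U (mem_set CU) x y (Itv01 os0 os1) Ux Uy; rewrite inE /=.
have <- : 1 - of_real s = of_real t.
  by rewrite -(of_real1 R k) -st of_realD addrC addKr.
by [].
Qed.

(* The gauge of the balanced core of a convex neighbourhood missing [x]. *)
Lemma separating_seminorm (x : g) : hausdorff_space g -> x != 0 ->
  exists2 p : g -> R, continuous_seminorm p & 1 <= p x.
Proof.
move=> hg x0; rewrite eq_sym in x0.
have [A [oA /set_mem A0 /set_mem Ax]] := hausdorff_accessible hg x0.
have [U [U0 UA Ucvx]] := locally_convex_nbhs0 (open_nbhs_nbhs (conj oA A0)).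
(* The largest balanced subset of [U]; it inherits convexity. *)
pose B : set g := [set y | forall a : K, modulus a <= 1 -> U (a *: y)].
have Bbal (a : K) y : modulus a <= 1 -> B y -> B (a *: y).
  move=> a1 By b b1; rewrite scalerA; apply: By.
  by rewrite modulusM mulr_ile1 ?modulus_ge0.
have Bcvx (s t : R) y z : 0 <= s -> 0 <= t -> s + t = 1 ->
    B y -> B z -> B (of_real s *: y + of_real t *: z).
  move=> s0 t0 st By Bz a a1; rewrite scalerDr !scalerA !(mulrC a) -!scalerA.
  by apply: Ucvx => //; [exact: By | exact: Bz].
have Bscale y (d : R) : 0 < d ->
    (forall a : K, modulus a <= d -> U (a *: y)) -> B (of_real d *: y).
  move=> d0 dU a a1; rewrite scalerA; apply: dU.
  by rewrite modulusM modulus_of_real gtr0_norm // ler_piMl // ltW.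
have Babs y : exists2 t : R, 0 < t & B (of_real t^-1 *: y).
  have [d d0 /nbhs_singleton dU] := scale_small y U0.
  by exists d^-1; rewrite ?invr_gt0 // invrK; exact: Bscale.
have B0 : \forall z \near (0 : g), B z.
  have [d d0 dU] := scale_small 0 U0.
  have d_neq0 : of_real d != 0 by rewrite gt_eqF // -(of_real0 R k) ltr_of_real.
  (* The neighbourhood on which [dU] holds, scaled by [d], lies in [B]. *)
  have := nbhs0Z d_neq0 dU; apply: filterS => _ [z dUz <-].
  exact: Bscale.
have sB := gauge_seminorm Bbal Bcvx Babs.
exists (gauge B).
  split=> //; apply: seminorm_continuous => // e e0.
  have e_neq0 : of_real e != 0 by rewrite gt_eqF // -(of_real0 R k) ltr_of_real.
  have := nbhs0Z e_neq0 B0; apply: filterS => _ [z Bz <-].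
  apply: gauge_le => //.
  by rewrite scalerA -of_realM mulVf ?gt_eqF // of_real1 scale1r.
apply: gauge_ge1 => // Bx; apply: Ax; apply: UA.
by have := Bx 1; rewrite scale1r modulus1; apply.
Qed.

End SeparatingSeminorm.

(** The case [xi = 0] is excluded because [exp 0 = 1] has finite seminorms for every [r]. *)
Theorem proposition3p5 (R : realType) (k : scalar_kind)
    (g : tvsType (scalars R k)) (br : {bilinear g -> g -> g})
    (AEg : AE_Lie_algebra br) (xi : g) (xi_neq0 : xi != 0)
    (r : R) (r_ge1 : 1 <= r) :
  ~ completed_sym_algebra r (exp_series xi).
Proof.
have [hg _ _ _] := AEg.
have [p cp p1] := separating_seminorm hg xi_neq0.
pose u n : R := n`!%:R `^ r * extension (sym_seminorm p) (exp_series xi n).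
have u1 n : 1 <= u n.
  have n0 : 1 <= n`!%:R :> R by rewrite ler1n fact_gt0.
  rewrite /u extension_sym_seminorm //.
  rewrite (sym_seminorm_seminorm n cp.1).2 -of_real_nat -of_realV.
  rewrite modulus_of_real ger0_norm ?invr_ge0 // mulrA -[leLHS]mulr1 ler_pM //.
    by rewrite ler_pdivlMr ?ltr0n ?fact_gt0 // !mul1r le1r_powR.
  apply: le_trans (proj_seminorm_diag_ge n xi cp.1).
  exact: exprn_ege1.
move=> /(_ p cp); rewrite ltNge => /negP; apply.
change (+oo <= \sum_(0 <= n <oo) (u n)%:E)%E.
rewrite leye_eq; apply/eqP/eqyP => A A0.
(* Each term is at least 1, so [N > A] of them already exceed [A]. *)
pose N := (Num.trunc A).+1.
apply: (@le_trans _ _ (\sum_(0 <= i < N) (u i)%:E)%E); last first.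
  by apply: nneseries_lim_ge => n _ _; rewrite lee_fin (le_trans ler01).
rewrite sumEFin lee_fin (le_trans (ltW (truncnS_gt A))) // -/N.
rewrite -[X in X%:R]subn0 -sumr_const_nat.
by apply: ler_sum => n _; exact: u1.
Qed.
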